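(* In $AdS_3$, the set of singularities of the non-rotating massive BTZ black hole, which in the embedding coordinates is the set $\{(u,t,x,y)\in AdS_3 : t^2-y^2=0\}$, coincides with the union of the closed orbits of the actions of the Iwasawa subgroups $AN$ and $A\overline{N}$ of $SO(2,2)$ on $AdS_3$.
   Context: $AdS_3=\{(u,t,x,y)\in\mathbb{R}^{2,2} : u^2+t^2-x^2-y^2=1\}$, identified with $SL_2(\mathbb{R})$ via $g=\begin{pmatrix} u+x & y+t \\ y-t & u-x \end{pmatrix}$ and endowed with the bi-invariant metric induced by the Killing form of $\mathfrak{sl}_2(\mathbb{R})$. The singularities of the non-rotating massive BTZ black hole are the points of $AdS_3$ where the identification vector field $\Xi=a(\overline{H_0}-\underline{H_0})$ has zero norm; here $a\in\mathbb{R}\setminus\{0\}$, $H_0=\mathrm{diag}(1,-1)$, and $\overline{H_0}$, $\underline{H_0}$ are the right- and left-invariant vector fields associated with $H_0$ ($\Xi$ generates the action $g\mapsto e^{saH_0}g\,e^{-saH_0}$). This set is $\{t^2-y^2=0\}$. $SO(2,2)$ acts linearly on $AdS_3$ in the coordinates $(u,t,x,y)$. Let $E_{ij}$ be the elementary $4\times4$ matrix with $1$ in position $(i,j)$, $J_1=E_{24}+E_{42}$, $J_2=E_{13}+E_{31}$, $$M=\begin{pmatrix} 0&1&0&-1 \\ -1&0&1&0 \\ 0&1&0&-1 \\ -1&0&1&0 \end{pmatrix},\qquad L=\begin{pmatrix} 0&1&0&-1 \\ -1&0&-1&0 \\ 0&-1&0&1 \\ -1&0&-1&0 \end{pmatrix}.$$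 Then $A=\exp(\mathrm{span}\{J_1,J_2\})$, $N=\exp(\mathrm{span}\{M,L\})$, and $\overline{N}=\theta(N)$, where $\theta$ is the Cartan involution, $\theta(X)=-X^T$ on the Lie algebra. *)

(* Defs.v *)
From HB Require Import structures.
From mathcomp Require Import all_boot all_order all_algebra.
From mathcomp Require Import all_classical all_reals all_analysis.

Set Implicit Arguments.
Unset Strict Implicit.
Unset Printing Implicit Defensive.

Import Order.TTheory GRing.Theory Num.Theory.
Import numFieldNormedType.Exports.
Local Open Scope classical_set_scope.
Local Open Scope ring_scope.

Section BTZ.
Variable R : realType.

(* A point of R^{2,2} is a column vector with entries (u, t, x, y), so that
   4 x 4 matrices act on it by left multiplication. *)
Definition cu (p : 'cV[R]_4) : R := p 0 0.
Definition ct (p : 'cV[R]_4) : R := p 1 0.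
Definition cx (p : 'cV[R]_4) : R := p 2 0.
Definition cy (p : 'cV[R]_4) : R := p 3 0.

Definition AdS3 : set 'cV[R]_4 :=
  [set p | cu p ^+ 2 + ct p ^+ 2 - cx p ^+ 2 - cy p ^+ 2 = 1].

Definition mx_of_seq m n (s : seq (seq R)) : 'M[R]_(m, n) :=
  \matrix_(i < m, j < n) (nth [::] s i)`_j.

Definition SL2_of (p : 'cV[R]_4) : 'M[R]_2 :=
  mx_of_seq 2 2 [:: [:: cu p + cx p; cy p + ct p];
                    [:: cy p - ct p; cu p - cx p]].

Definition lie_bracket n (X Y : 'M[R]_n) : 'M[R]_n := X *m Y - Y *m X.

Definition sl2_H : 'M[R]_2 := mx_of_seq 2 2 [:: [:: 1; 0]; [:: 0; -1]].
Definition sl2_E : 'M[R]_2 := mx_of_seq 2 2 [:: [:: 0; 1]; [:: 0; 0]].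
Definition sl2_F : 'M[R]_2 := mx_of_seq 2 2 [:: [:: 0; 0]; [:: 1; 0]].

Definition sl2_basis (j : 'I_3) : 'M[R]_2 :=
  nth 0 [:: sl2_H; sl2_E; sl2_F] j.

(* Coordinates in the basis (H, E, F); meaningful for traceless X. *)
Definition sl2_coord (X : 'M[R]_2) : 'cV[R]_3 :=
  \col_(i < 3) [:: X 0 0; X 0 1; X 1 0]`_i.

(* Matrix of ad X : sl_2 -> sl_2 in the basis (H, E, F). *)
Definition sl2_ad (X : 'M[R]_2) : 'M[R]_3 :=
  \matrix_(i < 3, j < 3) sl2_coord (lie_bracket X (sl2_basis j)) i 0.

Definition killing (X Y : 'M[R]_2) : R := \tr (sl2_ad X *m sl2_ad Y).

(* The tangent space of SL_2 at g is g sl_2, and the bi-invariant metric is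
   the left translate of the Killing form. *)
Definition SL2_metric (g V W : 'M[R]_2) : R :=
  killing (invmx g *m V) (invmx g *m W).

Definition right_invariant_field (X g : 'M[R]_2) : 'M[R]_2 := X *m g.
Definition left_invariant_field (X g : 'M[R]_2) : 'M[R]_2 := g *m X.

Definition btz_field (a : R) (g : 'M[R]_2) : 'M[R]_2 :=
  a *: (right_invariant_field sl2_H g - left_invariant_field sl2_H g).

Definition btz_singularities (a : R) : set 'cV[R]_4 :=
  [set p | AdS3 p /\
    let g := SL2_of p in SL2_metric g (btz_field a g) (btz_field a g) = 0].

Definition expmx n (X : 'M[R]_n.+1) : 'M[R]_n.+1 :=
  limn (series (fun k => k`!%:R^-1 *: X ^+ k)).

(* The elementary matrix E_ij, indexed from 1, is delta_mx with both indices
   shifted down by one. *)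
Definition J1 : 'M[R]_4 := delta_mx 1 3 + delta_mx 3 1.
Definition J2 : 'M[R]_4 := delta_mx 0 2 + delta_mx 2 0.

Definition matM : 'M[R]_4 :=
  mx_of_seq 4 4 [:: [:: 0; 1; 0; -1];
                    [:: -1; 0; 1; 0];
                    [:: 0; 1; 0; -1];
                    [:: -1; 0; 1; 0]].

Definition matL : 'M[R]_4 :=
  mx_of_seq 4 4 [:: [:: 0; 1; 0; -1];
                    [:: -1; 0; -1; 0];
                    [:: 0; -1; 0; 1];
                    [:: -1; 0; -1; 0]].

Definition lieA : set 'M[R]_4 := [set` <<[:: J1; J2]>>%VS].
Definition lieN : set 'M[R]_4 := [set` <<[:: matM; matL]>>%VS].

Definition cartan_theta (X : 'M[R]_4) : 'M[R]_4 := - X^T.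

Definition groupA : set 'M[R]_4 := @expmx 3 @` lieA.
Definition groupN : set 'M[R]_4 := @expmx 3 @` lieN.

(* On the group, the Cartan involution is exp X |-> exp (theta X). *)
Definition groupNbar : set 'M[R]_4 := @expmx 3 @` (cartan_theta @` lieN).

Definition mulset (G K : set 'M[R]_4) : set 'M[R]_4 :=
  [set g *m k | g in G & k in K].

Definition orbit_of (G : set 'M[R]_4) (p : 'cV[R]_4) : set 'cV[R]_4 :=
  [set g *m p | g in G].

(* Closedness is relative to AdS_3, through the subspace topology. *)
Definition closed_orbits (G : set 'M[R]_4) : set (set 'cV[R]_4) :=
  [set O | (exists2 p, AdS3 p & O = orbit_of G p) /\
           closed (O : set (subspace AdS3))].

End BTZ.

Arguments AdS3 {R}.
Arguments groupA {R}.
Arguments groupN {R}.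
Arguments groupNbar {R}.

(* Main.v *)
Require Import Defs.
From mathcomp Require Import all_boot all_order all_algebra.
From mathcomp Require Import all_classical all_reals all_analysis.
From mathcomp Require Import ring lra.

Set Implicit Arguments.
Unset Strict Implicit.
Unset Printing Implicit Defensive.

Import Order.TTheory GRing.Theory Num.Theory.
Import numFieldNormedType.Exports.
Local Open Scope classical_set_scope.
Local Open Scope ring_scope.

(** At a point g of SL_2(R), the identification field pulled back to the Lie
    algebra is a (g^-1 H g - H), and its Killing norm is
    32 a^2 (t^2 - y^2) ([SL2_metric_btz_field]); so the singular set is the
    union of the two null hypersurfaces t = y and t = - y.

    The orbits are read off in null coordinates.  For e = 1 or -1 put
    p = t - e y, q = t + e y, s = u - x, r = u + x, so that AdS_3 is the
    quadric p q + r s = 1 ([AdS3_null]).  The group A scales (p, q) by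
    (k, 1/k) and (r, s) by (h, 1/h) independently, with k, h > 0
    ([null_coord_boost]).  With e = 1, an element of N fixes p, adds arbitrary
    multiples of p to r and to s, and corrects q so as to stay on the quadric
    ([horospherical_exp]); with e = -1, the same holds for the opposite group
    ([horospherical_Nbar]), so both cases are treated at once, with e as a
    parameter.

    If p <> 0 at a point z of AdS_3, then r and s can be given any values and
    q follows from the equation of the quadric: the orbit of z is the part of
    AdS_3 where p has the sign of p(z) ([AN_nonnull_orbit]).  It is not closed,
    because it accumulates at points with p = 0
    ([nonnull_orbit_not_closed]).  If p(z) = 0, then r s = 1, the signs of r
    and s are preserved, and q can be given any value: the orbit is one of the
    two components of the hypersurface p = 0 ([AN_null_orbit]), and is closed
    ([null_orbit_closed]).  So the closed orbits of AN fill the hypersurface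
    t = y, those of the opposite group fill t = - y
    ([bigcup_closed_orbits]), and together they fill t^2 = y^2. *)

(** * Exponentials of matrices *)

Section Exponential.
Variables (R : realType) (n : nat).
Implicit Types X P : 'M[R]_n.+1.

Lemma expmx_cvg X Y : series (fun k => k`!%:R^-1 *: X ^+ k) @ \oo --> Y ->
  expmx X = Y.
Proof. by move=> XY; apply: cvg_lim XY. Qed.

Lemma expmx_nilpotent3 X : X ^+ 3 = 0 -> expmx X = 1 + X + 2^-1 *: X ^+ 2.
Proof.
move=> X3; apply: expmx_cvg; apply: cvg_near_cst.
exists 3%N => // k /= k3; rewrite /series /= -(subnKC k3).
elim: (k - 3)%N => [|j IH].
  rewrite addn0 !big_nat_recr //= big_nil.
  by rewrite add0r !factS fact0 expr0 expr1 !muln1 invr1 !scale1r.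
by rewrite addnS big_nat_recr //= IH exprD X3 mul0r scaler0 addr0.
Qed.

(** The rows of P are left eigenvectors of X, and exp X acts on each by the
    exponential of its eigenvalue. In this form the lemma describes
    the coordinates P z of a vector z under z |-> exp X z. *)
Lemma expmx_diagonalizable X P (d : 'rV[R]_n.+1) :
  P \in unitmx -> P *m X = diag_mx d *m P ->
  P *m expmx X = diag_mx (map_mx expR d) *m P.
Proof.
move=> Pu PX.
(* Decomposing X^k along the eigenprojections reduces the matrix series to
   the scalar series of exp, one for each eigenvalue. *)
have XE k : X ^+ k = \sum_i d 0 i ^+ k *: (invmx P *m delta_mx i i *m P).
  have -> : X ^+ k = invmx P *m diag_mx (map_mx (fun z => z ^+ k) d) *m P.
    elim: k => [|k IH].
      rewrite expr0 (_ : diag_mx _ = 1%:M) ?mulmx1 ?mulVmx //.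
      by apply/matrixP => i j; rewrite !mxE expr0.
    rewrite exprSr IH -[in LHS]mulmxE -!mulmxA PX; congr (_ *m _).
    rewrite !mulmxA; congr (_ *m _); rewrite mulmx_diag; congr diag_mx.
    by apply/rowP => i; rewrite !mxE exprSr.
  rewrite diag_mx_sum_delta mulmx_sumr mulmx_suml.
  by apply: eq_bigr => i _; rewrite mxE -scalemxAr -scalemxAl.
suff -> : expmx X = \sum_i expR (d 0 i) *: (invmx P *m delta_mx i i *m P).
  rewrite mulmx_sumr diag_mx_sum_delta mulmx_suml; apply: eq_bigr => i _.
  by rewrite -scalemxAr !mulmxA mulmxV // mul1mx mxE scalemxAl.
apply: expmx_cvg.
have -> : series (fun k => k`!%:R^-1 *: X ^+ k) =
    fun N => \sum_i series (exp_coeff (d 0 i)) N *: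
                 (invmx P *m delta_mx i i *m P).
  apply/funext => N; rewrite /series /=.
  under eq_bigr do rewrite XE scaler_sumr.
  rewrite exchange_big /=; apply: eq_bigr => i _; rewrite scaler_suml.
  by apply: eq_bigr => k _; rewrite scalerA /exp_coeff /= mulrC.
apply: cvg_big => [|i _]; first exact: add_continuous.
apply: cvgZr_tmp.
exact: is_cvg_series_exp_coeff.
Qed.

End Exponential.

(** * The norm of the identification field *)

Section Killing.
Variable R : realType.
Implicit Types (a : R) (X Y g : 'M[R]_2) (p : 'cV[R]_4).

Lemma mulmx2E X Y i j : (X *m Y) i j = X i 0 * Y 0 j + X i 1 * Y 1 j.
Proof.
rewrite mxE !big_ord_recl big_ord0 addr0.
by congr (X _ _ * Y _ _ + X _ _ * Y _ _); apply: val_inj.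
Qed.

Lemma mulmx3E (X Y : 'M[R]_3) i j :
  (X *m Y) i j = X i 0 * Y 0 j + X i 1 * Y 1 j + X i 2 * Y 2 j.
Proof.
rewrite mxE !big_ord_recl big_ord0 addr0 addrA.
by do ?congr (_ + _); congr (X _ _ * Y _ _); apply: val_inj.
Qed.

Lemma mx2P X Y : X 0 0 = Y 0 0 -> X 0 1 = Y 0 1 -> X 1 0 = Y 1 0 ->
  X 1 1 = Y 1 1 -> X = Y.
Proof.
move=> h00 h01 h10 h11; apply/matrixP => i j.
have ord2 (k : 'I_2) : k = 0 \/ k = 1.
  by case: k => [[|[|//]] ?]; [left|right]; apply: val_inj.
by case: (ord2 i) => ->; case: (ord2 j) => ->.
Qed.

(** The familiar Killing form 4 tr(X Y) of sl_2, on the diagonal. *)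
Lemma killing_traceless X : X 1 1 = - X 0 0 ->
  killing X X = 8 * (X 0 0 ^+ 2 + X 0 1 * X 1 0).
Proof.
move=> X11.
have adE : sl2_ad X = mx_of_seq 3 3
    [:: [:: 0; - X 1 0; X 0 1]; [:: - 2 * X 0 1; 2 * X 0 0; 0];
        [:: 2 * X 1 0; 0; - 2 * X 0 0]].
  apply/matrixP => i j; rewrite [LHS]mxE [LHS]mxE [RHS]mxE.
  by case: i => [[|[|[|//]]] ?]; case: j => [[|[|[|//]]] ?];
    rewrite /= mxE [X in _ + X]mxE !mulmx2E !mxE /= ?X11; ring.
rewrite /killing adE /mxtrace !big_ord_recl big_ord0 !mulmx3E !mxE /=.
by ring.
Qed.

Lemma AdS3_u2 p : AdS3 p -> cu p ^+ 2 = 1 - ct p ^+ 2 + cx p ^+ 2 + cy p ^+ 2.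
Proof. by rewrite /AdS3 /= => <-; ring. Qed.

(** Translated back to the identity, the field is a (g^-1 H g - H); the entries
    of W are those of this difference after using det g = 1. *)
Lemma btz_fieldE a p : AdS3 p ->
  let g := SL2_of p in
  let W := mx_of_seq 2 2
    [:: [:: 2 * (cy p ^+ 2 - ct p ^+ 2);
            2 * (cy p + ct p) * (cu p - cx p)];
        [:: - 2 * (cu p + cx p) * (cy p - ct p);
            - (2 * (cy p ^+ 2 - ct p ^+ 2))]] in
  invmx g *m btz_field a g = a *: W.
Proof.
move=> /AdS3_u2 u2 /=.
set g := SL2_of p; set W := mx_of_seq _ _ _.
(* h is the adjugate of g, hence its inverse on SL_2. *)
pose h : 'M[R]_2 := mx_of_seq 2 2 [:: [:: cu p - cx p; - (cy p + ct p)];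
                          [:: - (cy p - ct p); cu p + cx p]].
have gh : g *m h = 1%:M.
  by apply: mx2P; rewrite mulmx2E !mxE /=; ring: u2.
have [gu _] := mulmx1_unit gh.
rewrite -[RHS](mulKmx gu); congr (_ *m _).
rewrite -scalemxAr; congr (_ *: _).
by apply: mx2P; rewrite mulmx2E /right_invariant_field /left_invariant_field
     mxE [X in _ + X]mxE !mulmx2E !mxE /=; ring: u2.
Qed.

Lemma SL2_metric_btz_field a p : AdS3 p ->
  let g := SL2_of p in
  SL2_metric g (btz_field a g) (btz_field a g) =
    32 * a ^+ 2 * (ct p ^+ 2 - cy p ^+ 2).
Proof.
move=> p1 /=; rewrite /SL2_metric btz_fieldE // killing_traceless !mxE /=.
  by ring: (AdS3_u2 p1).
by ring.
Qed.

Lemma btz_singularitiesE a : a != 0 -> btz_singularities a =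
  [set p : 'cV[R]_4 | AdS3 p /\ ct p ^+ 2 - cy p ^+ 2 = 0].
Proof.
move=> a0; apply/seteqP; split=> p [p1].
  rewrite /= SL2_metric_btz_field // => /eqP.
  by rewrite !mulf_eq0 pnatr_eq0 (negPf a0) => /eqP.
by move=> ty0; split=> //=; rewrite SL2_metric_btz_field // ty0 mulr0.
Qed.

End Killing.

(** * Null coordinates on R^{2,2} *)

Section NullCoordinates.
Variable R : realType.
Implicit Types (e a b m l : R) (z w : 'cV[R]_4) (X : 'M[R]_4).

Lemma mulmx_col4 X z i : (X *m z) i 0 =
  X i 0 * cu z + X i 1 * ct z + X i 2 * cx z + X i 3 * cy z.
Proof.
rewrite mxE !big_ord_recl big_ord0 addr0 !addrA.
by do 3?[congr (_ + _)]; congr (X _ _ * z _ _); apply: val_inj.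
Qed.

Definition mulmx_coordE X z :=
  (mulmx_col4 X z 0 : cu (X *m z) = _, mulmx_col4 X z 1 : ct (X *m z) = _,
   mulmx_col4 X z 2 : cx (X *m z) = _, mulmx_col4 X z 3 : cy (X *m z) = _).

Lemma ord4P (i : 'I_4) : [\/ i = 0, i = 1, i = 2 | i = 3].
Proof.
by case: i => [[|[|[|[|//]]]] ?];
  [constructor 1|constructor 2|constructor 3|constructor 4]; apply: val_inj.
Qed.

(** The null coordinates of the (t, y) and (u, x) planes. With e = 1 or -1 and
    z given, comments below write p, q, s, r for [null_ty e z],
    [null_ty (- e) z], [null_ux 1 z], [null_ux (- 1) z]. *)
Definition null_ty e z : R := ct z - e * cy z.
Definition null_ux e z : R := cu z - e * cx z.

Lemma null_coordP e z w : e ^+ 2 = 1 ->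
  null_ty e z = null_ty e w -> null_ty (- e) z = null_ty (- e) w ->
  null_ux 1 z = null_ux 1 w -> null_ux (- 1) z = null_ux (- 1) w -> z = w.
Proof.
rewrite /null_ty /null_ux => e2 p q s r.
have zu : cu z = cu w by lra.
have zt : ct z = ct w by lra.
have zx : cx z = cx w by lra.
have ey : e * cy z = e * cy w by lra.
have zy : cy z = cy w.
  by rewrite -[LHS]mul1r -[RHS]mul1r -e2 expr2 -!mulrA ey.
apply/matrixP => i j; rewrite (ord1 j).
by case: (ord4P i) => ->.
Qed.

Lemma AdS3_null e z : e ^+ 2 = 1 ->
  AdS3 z <->
  null_ux 1 z * null_ux (- 1) z + null_ty e z * null_ty (- e) z = 1.
Proof.
move=> e2; rewrite /AdS3 /null_ty /null_ux /=.
have -> :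
  (cu z - 1 * cx z) * (cu z - -1 * cx z) +
   (ct z - e * cy z) * (ct z - - e * cy z) =
   cu z ^+ 2 + ct z ^+ 2 - cx z ^+ 2 - e ^+ 2 * cy z ^+ 2 by ring.
by rewrite e2 mul1r.
Qed.

Lemma null_ux_neq0 e z : e ^+ 2 = 1 -> AdS3 z -> null_ty e z = 0 ->
  null_ux 1 z != 0.
Proof.
move=> e2 /(AdS3_null _ e2) z1 p0; apply/eqP => s0.
by move/eqP: z1; rewrite s0 p0 !mul0r addr0 eq_sym oner_eq0.
Qed.

(** * The action of the Iwasawa subgroups in null coordinates *)

(** The null coordinates diagonalize span(J1, J2): its elements are the
    infinitesimal boosts of the (t, y) and (u, x) planes. *)
Lemma null_coord_boost a b e z : e ^+ 2 = 1 ->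
  let g := expmx (a *: J1 R + b *: J2 R) in
  null_ty e (g *m z) = expR (- (e * a)) * null_ty e z /\
  null_ux e (g *m z) = expR (- (e * b)) * null_ux e z.
Proof.
move=> e2 g.
(* The rows of P are the null coordinates (for e = 1), which are orthogonal of
   squared length 2. *)
pose P : 'M[R]_4 := mx_of_seq 4 4
  [:: [:: 0; 1; 0; -1]; [:: 0; 1; 0; 1]; [:: 1; 0; -1; 0]; [:: 1; 0; 1; 0]].
pose d : 'rV[R]_4 := \row_j [:: - a; a; - b; b]`_j.
have Pz w : [/\ (P *m w) 0 0 = null_ty 1 w, (P *m w) 1 0 = null_ty (- 1) w,
    (P *m w) 2 0 = null_ux 1 w & (P *m w) 3 0 = null_ux (- 1) w].
  by split; rewrite mulmx_col4 !mxE /= /null_ty /null_ux; ring.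
have Pu : P \in unitmx.
  suff /mulmx1_unit[] : P *m (2^-1 *: P^T) = 1%:M by [].
  apply/matrixP => i j; rewrite mxE !big_ord_recl big_ord0.
  by case: (ord4P i) => ->; case: (ord4P j) => ->; rewrite !mxE /=; field.
have PX : P *m (a *: J1 R + b *: J2 R) = diag_mx d *m P.
  rewrite mul_diag_mx; apply/matrixP => i j.
  rewrite [LHS]mxE !big_ord_recl big_ord0.
  by case: (ord4P i) => ->; case: (ord4P j) => ->; rewrite !mxE /=; ring.
have gE := expmx_diagonalizable Pu PX.
have gz i : (P *m (g *m z)) i 0 = expR (d 0 i) * (P *m z) i 0.
  by rewrite mulmxA gE -mulmxA mul_diag_mx !mxE.
have [P0 P1 P2 P3] := Pz z.
have [Q0 Q1 Q2 Q3] := Pz (g *m z).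
have /orP[/eqP->|/eqP->] : (e == 1) || (e == -1) by rewrite -sqrf_eq1 e2.
  by rewrite -P0 -Q0 -P2 -Q2 !gz !mxE /= !mul1r.
by rewrite -P1 -Q1 -P3 -Q3 !gz !mxE /= !mulNr !mul1r !opprK.
Qed.

(** X generates the infinitesimal motion dp = 0, dr = 2 m p, ds = 2 l p, whose
    dq is then forced by d(p q + r s) = 0. *)
Definition horospherical e m l X := forall z,
  [/\ null_ty e (X *m z) = 0,
      null_ty (- e) (X *m z) = - 2 * (m * null_ux 1 z + l * null_ux (- 1) z),
      null_ux 1 (X *m z) = 2 * l * null_ty e z &
      null_ux (- 1) (X *m z) = 2 * m * null_ty e z].

Lemma horospherical_N m l : horospherical 1 m l (m *: matM R + l *: matL R).
Proof.
move=> z; split; rewrite /null_ty /null_ux !mulmx_coordE !mxE /=; ring.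
Qed.

(** The Cartan involution exchanges the roles of p and q, that is e with -e; it
    also exchanges those of the two parameters. *)
Lemma horospherical_Nbar m l :
  horospherical (- 1) l m (cartan_theta (m *: matM R + l *: matL R)).
Proof.
move=> z; split; rewrite /null_ty /null_ux !mulmx_coordE !mxE /=; ring.
Qed.

Lemma null_tyD e z w : null_ty e (z + w) = null_ty e z + null_ty e w.
Proof. by rewrite /null_ty /ct /cy !mxE; ring. Qed.
Lemma null_tyZ e a z : null_ty e (a *: z) = a * null_ty e z.
Proof. by rewrite /null_ty /ct /cy !mxE; ring. Qed.
Lemma null_uxD e z w : null_ux e (z + w) = null_ux e z + null_ux e w.
Proof. by rewrite /null_ux /cu /cx !mxE; ring. Qed.
Lemma null_uxZ e a z : null_ux e (a *: z) = a * null_ux e z.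
Proof. by rewrite /null_ux /cu /cx !mxE; ring. Qed.

(** As a derivation on the null coordinates, X maps q to a combination of r and
    s, these to multiples of p, and p to 0, so X^3 = 0 and the exponential
    stops at the quadratic term, which moves only q. *)
Lemma horospherical_exp e m l X z : e ^+ 2 = 1 -> horospherical e m l X ->
  let n := expmx X in
  [/\ null_ty e (n *m z) = null_ty e z,
      null_ty (- e) (n *m z) = null_ty (- e) z
        - 2 * (m * null_ux 1 z + l * null_ux (- 1) z)
        - 4 * m * l * null_ty e z,
      null_ux 1 (n *m z) = null_ux 1 z + 2 * l * null_ty e z &
      null_ux (- 1) (n *m z) = null_ux (- 1) z + 2 * m * null_ty e z].
Proof.
move=> e2 hX.
have X3 : X ^+ 3 = 0.
  (* The null coordinates of X^3 v vanish, for every vector v. *)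
  suff X3v (v : 'cV[R]_4) : X ^+ 3 *m v = 0.
    apply/matrixP => i j.
    have -> : (X ^+ 3) i j = col j (X ^+ 3) i 0 by rewrite [RHS]mxE.
    by rewrite colE X3v !mxE.
  rewrite !exprS expr0 mulr1 -!mulmxE -!mulmxA.
  have [p1 q1 s1 r1] := hX v.
  have [p2 q2 s2 r2] := hX (X *m v).
  have [p3 q3 s3 r3] := hX (X *m (X *m v)).
  apply: (null_coordP e2); rewrite ?p3 ?q3 ?s3 ?r3 ?s2 ?r2 ?p2 ?p1
    /null_ty /null_ux /cu /ct /cx /cy !mxE; ring.
rewrite /= (expmx_nilpotent3 X3) !mulmxDl mul1mx -scalemxAl expr2 -mulmxE
  -mulmxA.
have [p1 q1 s1 r1] := hX z.
have [p2 q2 s2 r2] := hX (X *m z).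
rewrite !null_tyD !null_uxD !null_tyZ !null_uxZ p2 q2 s2 r2 p1 q1 s1 r1.
by split; field.
Qed.


Lemma span2P (X Y Z : 'M[R]_4) :
  Z \in <<[:: X; Y]>>%VS <-> exists a b, Z = a *: X + b *: Y.
Proof.
rewrite span_cons span_seq1; split.
  move=> /memv_addP[_ /vlineP[a ->] [_ /vlineP[b ->] ->]].
  by exists a, b.
by move=> [a [b ->]]; rewrite memv_add // memvZ // memv_line.
Qed.

(** What the orbits of A exp(K) depend on; it holds for the Lie algebra of N
    with e = 1 and for its image by the Cartan involution with e = -1. *)
Definition horospheric_algebra e (K : set 'M[R]_4) :=
  (forall X, K X -> exists m l, horospherical e m l X) /\
  (forall m l, exists2 X, K X & horospherical e m l X).

Lemma horospheric_algebra_N : horospheric_algebra 1 (@lieN R).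
Proof.
split=> [X /span2P[m [l ->]]|m l]; first by exists m, l; exact: horospherical_N.
exists (m *: matM R + l *: matL R); last exact: horospherical_N.
by apply/span2P; exists m, l.
Qed.

Lemma horospheric_algebra_Nbar :
  horospheric_algebra (- 1) (@cartan_theta R @` @lieN R).
Proof.
split=> [_ [X /span2P[m [l ->]] <-]|m l].
  by exists l, m; exact: horospherical_Nbar.
exists (cartan_theta (l *: matM R + m *: matL R)).
  by exists (l *: matM R + m *: matL R) => //; apply/span2P; exists l, m.
exact: horospherical_Nbar.
Qed.

(** w is reached from z by a horospherical motion with parameters m and l
    followed by a boost with parameters a and b. *)
Definition AN_related e z w := exists a b m l,
  [/\ null_ty e w = expR a * null_ty e z,
      null_ty (- e) w = expR (- a) * (null_ty (- e) z
        - 2 * (m * null_ux 1 z + l * null_ux (- 1) z)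
        - 4 * m * l * null_ty e z),
      null_ux 1 w = expR b * (null_ux 1 z + 2 * l * null_ty e z) &
      null_ux (- 1) w = expR (- b) * (null_ux (- 1) z + 2 * m * null_ty e z)].

Lemma orbit_AN e (K : set 'M[R]_4) z : e ^+ 2 = 1 -> horospheric_algebra e K ->
  orbit_of (mulset groupA (@expmx R 3 @` K)) z = [set w | AN_related e z w].
Proof.
move=> e2 [KH HK].
have eN2 : (- e) ^+ 2 = 1 by rewrite sqrrN.
have one2 : 1 ^+ 2 = 1 :> R by rewrite expr1n.
have mone2 : (- 1) ^+ 2 = 1 :> R by rewrite sqrrN.
apply/seteqP; split.
  move=> _ [_ [g [_ /span2P[a [b ->]] <-]] [n [X KX <-] <-]] <-.
  have [m [l hX]] := KH _ KX.
  have [pE qE sE rE] := horospherical_exp z e2 hX.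
  exists (- (e * a)), (- b), m, l.
  rewrite -!mulmxA -qE -sE -rE -pE; set v := expmx X *m z.
  have [-> _] := null_coord_boost a b v e2.
  have [-> _] := null_coord_boost a b v eN2.
  have [_ ->] := null_coord_boost a b v one2.
  have [_ ->] := null_coord_boost a b v mone2.
  by rewrite !mulNr !mul1r.
move=> w [a [b [m [l [pw qw sw rw]]]]].
have [X KX hX] := HK m l.
have [pE qE sE rE] := horospherical_exp z e2 hX.
pose Y := (- (e * a)) *: J1 R + (- b) *: J2 R.
exists (expmx Y *m expmx X).
  exists (expmx Y).
    by exists Y => //; apply/span2P; exists (- (e * a)), (- b).
  by exists (expmx X) => //; exists X.
rewrite -mulmxA; set v := expmx X *m z.
apply: (null_coordP e2).
- have [-> _] := null_coord_boost (- (e * a)) (- b) v e2.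
  by rewrite pw -pE mulrN opprK mulrA -expr2 e2 mul1r.
- have [-> _] := null_coord_boost (- (e * a)) (- b) v eN2.
  by rewrite qw -qE mulrNN mulrA -expr2 e2 mul1r.
- have [_ ->] := null_coord_boost (- (e * a)) (- b) v one2.
  by rewrite sw -sE mul1r opprK.
- have [_ ->] := null_coord_boost (- (e * a)) (- b) v mone2.
  by rewrite rw -rE mulrNN mul1r.
Qed.

Lemma AN_related_AdS3 e z w : e ^+ 2 = 1 -> AdS3 z -> AN_related e z w ->
  AdS3 w.
Proof.
move=> e2 /(AdS3_null _ e2) z1 [a [b [m [l [pw qw sw rw]]]]].
apply/(AdS3_null _ e2); rewrite pw qw sw rw.
rewrite (mulrACA (expR b)) (mulrACA (expR a)) -!expRD !subrr !expR0.
rewrite !mul1r -[RHS]z1.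
by ring.
Qed.

(** * Orbits and their closedness *)

Lemma expR_ratio (x y : R) : 0 < x * y -> exists a, x = expR a * y.
Proof.
move=> xy; exists (ln (x / y)).
have y0 : y != 0 by apply: contraTneq xy => ->; rewrite mulr0 ltxx.
rewrite lnK ?divfK // posrE.
rewrite (_ : x / y = x * y / y ^+ 2); last by field.
by rewrite divr_gt0 // exprn_even_gt0.
Qed.

Lemma expR_ratio_gt0 (x y a : R) : y != 0 -> x = expR a * y -> 0 < x * y.
Proof.
move=> y0 ->; rewrite -mulrA mulr_gt0 ?expR_gt0 // -expr2.
by rewrite exprn_even_gt0.
Qed.

Lemma AN_nonnull_orbit e z : e ^+ 2 = 1 -> AdS3 z -> null_ty e z != 0 ->
  [set w | AN_related e z w] =
  AdS3 `&` [set w | 0 < null_ty e w * null_ty e z].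
Proof.
move=> e2 z1 p0; apply/seteqP; split=> w /=.
  move=> zw; split; first exact: AN_related_AdS3 zw.
  by case: zw => [a [b [m [l [pw _ _ _]]]]]; exact: expR_ratio_gt0 pw.
move=> [/(AdS3_null _ e2) w1 /[dup] pp /expR_ratio[a pw]].
have /(AdS3_null _ e2) z1' := z1.
have pw0 : null_ty e w != 0 by apply: contraTneq pp => ->; rewrite mul0r ltxx.
have ea : expR a = null_ty e w / null_ty e z by rewrite pw mulfK.
(* The boost in the (t, y) plane adjusts p; then m and l adjust r and s, which
   is possible because p <> 0; q is determined by p, r, s on the quadric. *)
exists a, 0, ((null_ux (- 1) w - null_ux (- 1) z) / (2 * null_ty e z)),
  ((null_ux 1 w - null_ux 1 z) / (2 * null_ty e z)).
split=> //; last 2 first.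
- by rewrite expR0; field.
- by rewrite oppr0 expR0; field.
rewrite expRN ea; apply: (mulfI pw0).
rewrite -[LHS](addKr (null_ux 1 w * null_ux (- 1) w)) w1 -[X in _ + X = _]z1'.
by field; rewrite p0 pw0.
Qed.

Lemma AN_null_orbit e z : e ^+ 2 = 1 -> AdS3 z -> null_ty e z = 0 ->
  [set w | AN_related e z w] =
  AdS3 `&` [set w | null_ty e w = 0 /\ 0 < null_ux 1 w * null_ux 1 z].
Proof.
move=> e2 z1 p0.
have s0 := null_ux_neq0 e2 z1 p0.
have /(AdS3_null _ e2) z1' := z1.
rewrite p0 mul0r addr0 in z1'.
apply/seteqP; split=> w /=.
  move=> zw; split; first exact: AN_related_AdS3 zw.
  case: zw => [a [b [m [l [pw _ sw _]]]]]; rewrite pw p0 mulr0; split=> //.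
  by move: sw; rewrite p0 mulr0 addr0; exact: expR_ratio_gt0.
move=> [/(AdS3_null _ e2) w1 [pw0 /[dup] ss /expR_ratio[b sw]]].
rewrite pw0 mul0r addr0 in w1.
have sw0 : null_ux 1 w != 0 by apply: contraTneq ss => ->; rewrite mul0r ltxx.
have rz : null_ux (- 1) z = (null_ux 1 z)^-1.
  by apply: (mulfI s0); rewrite z1' divff.
have rw : null_ux (- 1) w = (null_ux 1 w)^-1.
  by apply: (mulfI sw0); rewrite w1 divff.
have eb : expR b = null_ux 1 w / null_ux 1 z by rewrite sw mulfK.
(* Now r s = 1: the boost in the (u, x) plane adjusts s, hence r, and m adjusts
   q, since s <> 0. *)
exists 0, b, ((null_ty (- e) z - null_ty (- e) w) / (2 * null_ux 1 z)), 0.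
rewrite pw0 p0 !mulr0 !addr0 subr0 mul0r addr0 oppr0 expR0; split=> //.
  by field.
by rewrite rw rz expRN eb; field; rewrite s0.
Qed.

Lemma continuous_null_ty e : continuous (null_ty e).
Proof.
rewrite /null_ty /ct /cy => z.
have coordC (i : 'I_4) : {for z, continuous (fun w : 'cV[R]_4 => w i 0)}.
  exact: coord_continuous.
exact: (continuousB (coordC 1)
          (continuousM (@cst_continuous _ _ e _) (coordC 3))).
Qed.

Lemma continuous_null_ux e : continuous (null_ux e).
Proof.
rewrite /null_ux /cu /cx => z.
have coordC (i : 'I_4) : {for z, continuous (fun w : 'cV[R]_4 => w i 0)}.
  exact: coord_continuous.
exact: (continuousB (coordC 0)
          (continuousM (@cst_continuous _ _ e _) (coordC 2))).
Qed.

Lemma null_orbit_closed e z : e ^+ 2 = 1 -> AdS3 z -> null_ty e z = 0 ->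
  closed ([set w | AN_related e z w] : set (subspace AdS3)).
Proof.
move=> e2 z1 p0; rewrite AN_null_orbit //.
have s0 := null_ux_neq0 e2 z1 p0.
(* The condition 0 < s(w) s(z) may be relaxed to 0 <= s(w) s(z), which is
   closed, because s vanishes nowhere on the part of AdS_3 where p = 0. *)
apply/closed_subspaceP.
exists (null_ty e @^-1` [set 0] `&`
        (fun w => null_ux 1 w * null_ux 1 z) @^-1` [set x | 0 <= x]).
  apply: closedI; apply: preimage_closed.
  - by move=> w _; exact: continuous_null_ty.
  - exact: closed_eq.
  - move=> w _; apply: continuousM; first exact: continuous_null_ux.
    exact: cst_continuous.
  - exact: closed_ge.
apply/seteqP; split=> w /= => [[[pw ss] w1]|[[w1 [pw ss]] _]]; last first.
  by split=> //; split=> //; exact: ltW.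
split=> //; split=> //; split=> //; rewrite lt_def ss andbT mulf_neq0 //.
exact: null_ux_neq0 e2 w1 pw.
Qed.

(** The curve r = s = 1, p = 2 c, q = 0 in AdS_3, which crosses the null
    hypersurface p = 0 transversally. *)
Definition crossing_curve e c : 'cV[R]_4 :=
  delta_mx 0 0 + c *: (delta_mx 1 0 - e *: delta_mx 3 0).

Lemma crossing_curve_null e c : e ^+ 2 = 1 ->
  AdS3 (crossing_curve e c) /\ null_ty e (crossing_curve e c) = 2 * c.
Proof.
move=> e2; rewrite /AdS3 /null_ty /cu /ct /cx /cy /= !mxE /=; split.
  by ring: e2.
by ring: e2.
Qed.

(** Along a curve crossing p = 0 in AdS_3, the orbit is the half where p has a
    given sign, and this half does not contain its endpoint. *)
Lemma nonnull_orbit_not_closed e z : e ^+ 2 = 1 -> AdS3 z -> null_ty e z != 0 ->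
  ~ closed ([set w | AN_related e z w] : set (subspace AdS3)).
Proof.
move=> e2 z1 p0; rewrite AN_nonnull_orbit // => /closed_subspaceP[V cV VE].
have VP w : AdS3 w -> V w <-> 0 < null_ty e w * null_ty e z.
  move=> w1; split=> [Vw|pp].
    by have [[_ ?] _] : ((AdS3 `&` [set w | 0 < null_ty e w * null_ty e z])
       `&` AdS3) w by rewrite -VE.
  by have [] : (V `&` AdS3) w by rewrite VE.
pose curve c := crossing_curve e (c * null_ty e z).
(* The factor p(z) orients the curve so that the orbit is the half c > 0. *)
have VcurveE c : V (curve c) <-> 0 < c.
  have [c1 pc] := crossing_curve_null (c * null_ty e z) e2.
  rewrite VP // pc; split.
    by rewrite -!mulrA -expr2 pmulr_rgt0 // pmulr_lgt0 // exprn_even_gt0.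
  by move=> c0; rewrite -!mulrA -expr2 mulr_gt0 // mulr_gt0 // exprn_even_gt0.
have curveC : continuous curve.
  move=> c; apply: cvgD; first exact: cvg_cst.
  by apply: cvgZr_tmp; apply: cvgM; [exact: cvg_id|exact: cvg_cst].
have cl : closed (curve @^-1` V).
  by apply: preimage_closed => // c _; exact: curveC.
have : V (curve 0).
  apply: cl => B [d /= d0 dB].
  exists (d / 2); split; first by apply/VcurveE; rewrite divr_gt0.
  apply: dB; rewrite /ball /= sub0r normrN gtr0_norm ?divr_gt0 //.
  by rewrite ltr_pdivrMr // ltr_pMr // ltr1n.
by rewrite VcurveE ltxx.
Qed.

Lemma bigcup_closed_orbits e G : e ^+ 2 = 1 ->
  (forall z, orbit_of G z = [set w | AN_related e z w]) ->
  \bigcup_(O in closed_orbits G) O = [set z | AdS3 z /\ null_ty e z = 0].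
Proof.
move=> e2 GE; apply/seteqP; split=> z.
  move=> [orb [] [w w1 ->]]; rewrite GE => Ocl.
  have [w0|/eqP w0] := pselect (null_ty e w = 0).
    by rewrite AN_null_orbit // => -[? []].
  by have := nonnull_orbit_not_closed e2 w1 w0.
move=> [z1 z0]; exists [set w | AN_related e z w].
  by split; [exists z|exact: null_orbit_closed].
by exists 0, 0, 0, 0; split; rewrite ?oppr0 expR0; ring.
Qed.

End NullCoordinates.

Theorem proposition9 (R : realType) (a : R) (ha : a != 0) :
  btz_singularities a =
    [set p : 'cV[R]_4 | AdS3 p /\ ct p ^+ 2 - cy p ^+ 2 = 0] /\
  btz_singularities a =
    \bigcup_(O in closed_orbits (mulset groupA groupN)) O `|`
    \bigcup_(O in closed_orbits (mulset groupA groupNbar)) O.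
Proof.
rewrite btz_singularitiesE //; split=> //.
have one2 : 1 ^+ 2 = 1 :> R by rewrite expr1n.
have mone2 : (- 1) ^+ 2 = 1 :> R by rewrite sqrrN.
rewrite (bigcup_closed_orbits one2); last first.
  by move=> z; apply: orbit_AN => //; exact: horospheric_algebra_N.
rewrite (bigcup_closed_orbits mone2); last first.
  by move=> z; apply: orbit_AN => //; exact: horospheric_algebra_Nbar.
have tyE (z : 'cV[R]_4) :
    ct z ^+ 2 - cy z ^+ 2 = null_ty 1 z * null_ty (- 1) z.
  by rewrite /null_ty; ring.
apply/seteqP; split=> z /=.
  move=> [z1 /eqP]; rewrite tyE mulf_eq0 => /orP[]/eqP ?; [by left|by right].
by move=> [] [z1 z0]; split=> //; rewrite tyE z0 ?mul0r ?mulr0.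
Qed.
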